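(* Let $\mathcal{S}=\{x\in\mathbb{R}^n : x^\top x=1\}$, let $f:\mathbb{R}^n\to\mathbb{R}$ be smooth, Lipschitz continuous with parameter $L_f^0\ge 0$, and satisfy for some $L_f\ge 0$ the inequality $f(y)\le f(x)+\langle\nabla f(x),y-x\rangle+\frac{L_f}{2}\|y-x\|^2$ for all $x,y\in\mathbb{R}^n$. Let $\sigma>0$ and $\upsilon>0$, and consider the two problems $$\text{(P0)}\quad \min_{x\in\mathcal{S}} f(x)+\sigma\|x\|_0,\qquad \text{(P1)}\quad \min_{x\in\mathcal{S}} f(x)+\sigma\,\Phi_\upsilon(x),\quad \Phi_\upsilon(x)=\sum_{i=1}^n\min\{\upsilon|x_{(i)}|,1\}.$$ If $\upsilon\ge L_f^0/\sigma+\sqrt{n}$, then (P0) and (P1) have the same set of global minimizers. Moreover, any local minimizer of (P1) is also a local minimizer of (P0).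
   Context: $\|\cdot\|$ is the Euclidean norm; $x_{(i)}$ is the $i$-th entry of $x$; $\|x\|_0$ is the number of nonzero entries of $x$. A local minimizer over $\mathcal{S}$ is a point of $\mathcal{S}$ minimizing the objective over the intersection of $\mathcal{S}$ with some neighborhood of that point. *)

(* Defs.v *)
From HB Require Import structures.
From mathcomp Require Import all_boot all_order all_algebra.
From mathcomp Require Import all_classical all_reals all_analysis.

Set Implicit Arguments.
Unset Strict Implicit.
Unset Printing Implicit Defensive.

Import Order.TTheory GRing.Theory Num.Theory.
Import numFieldNormedType.Exports.

Local Open Scope classical_set_scope.
Local Open Scope ring_scope.

Section euclidean.
Context {R : realType} {n : nat}.
Implicit Types (x y : 'rV[R]_n) (f : 'rV[R]_n -> R).

Definition dot x y : R := \sum_(i < n) x 0 i * y 0 i.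

(* The library norm `|x| on 'rV[R]_n is the sup norm, hence this separate
   Euclidean norm. The library topology is the usual one of R^n. *)
Definition enorm x : R := Num.sqrt (dot x x).

Definition sphere : set 'rV[R]_n := [set x | dot x x = 1].

Definition l0norm x : nat := #|[set i : 'I_n | x 0 i != 0]%SET|.

Definition capped_l1 (upsilon : R) x : R :=
  \sum_(i < n) Num.min (upsilon * `|x 0 i|) 1.

Definition grad f x : 'rV[R]_n := \row_(i < n) 'D_(delta_mx 0 i) f x.

(* Continuous differentiability (C^1). *)
Definition smooth f : Prop :=
  (forall x, differentiable f x) /\ continuous (grad f).

Definition elipschitz (L : R) f : Prop :=
  forall x y, `|f x - f y| <= L * enorm (x - y).

Definition global_minimizers (S : set 'rV[R]_n) f : set 'rV[R]_n :=
  [set x | S x /\ forall y, S y -> f x <= f y].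

Definition local_minimizers (S : set 'rV[R]_n) f : set 'rV[R]_n :=
  [set x | S x /\ \forall y \near x, S y -> f x <= f y].

Definition P0_obj f (sigma : R) x : R := f x + sigma * (l0norm x)%:R.

Definition P1_obj f (sigma upsilon : R) x : R :=
  f x + sigma * capped_l1 upsilon x.

End euclidean.

(* Main.v *)
(* Some entry of a point x of the sphere satisfies |x_j| >= 1 / sqrt n, hence
   upsilon |x_j| >= 1. If another entry satisfies 0 < |x_i| < 1 / upsilon, then
   decreasing |x_i| by t and increasing |x_j| so as to stay on the sphere lowers
   sigma Phi by exactly sigma upsilon t, while f grows by at most
   L t (1 + |x_i| / |x_j|), which is smaller. So local minimizers of (P1) have no
   such small entry, and there Phi agrees with the l0 norm, which it bounds from
   below everywhere. Taking t = |x_i| repeatedly removes all small entries of any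
   point without increasing the objective of (P1), so the inclusion of the global
   minimizers of (P0) in those of (P1) needs no compactness argument. *)
Require Import Defs.
From HB Require Import structures.
From mathcomp Require Import all_boot all_order all_algebra.
From mathcomp Require Import ring lra.
From mathcomp Require Import all_classical all_reals all_analysis.

Set Implicit Arguments.
Unset Strict Implicit.
Unset Printing Implicit Defensive.

Import Order.TTheory GRing.Theory Num.Theory.
Import numFieldNormedType.Exports.

Local Open Scope classical_set_scope.
Local Open Scope ring_scope.

Lemma sum_split2 (V : zmodType) (I : finType) (i j : I) (F : I -> V) :
  i != j -> \sum_k F k = F i + (F j + \sum_(k | (k != i) && (k != j)) F k).
Proof. by move=> ij; rewrite (bigD1 i) //= (bigD1 j) //= eq_sym. Qed.

(** * Entries, penalties and norm-preserving moves on the sphere *)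

Section sphere_descent.
Context {R : realType} {n : nat}.
Implicit Types (x y : 'rV[R]_n) (upsilon : R).

Lemma entry_le_enorm x k : `|x 0 k| <= enorm x.
Proof.
rewrite -sqrtr_sqr ler_wsqrtr// /dot (bigD1 k)//= -expr2 lerDl.
by apply: sumr_ge0 => l _; rewrite -expr2 sqr_ge0.
Qed.

(** Otherwise [n * x_k ^ 2 < 1] for every [k], and summing over [k] gives [n < n]. *)
Lemma sphere_large_entry x :
  sphere x -> exists j, 1 <= Num.sqrt n%:R * `|x 0 j|.
Proof.
rewrite /sphere/= => xS; apply/existsP; apply: contraT => /existsPn small.
have : \sum_(k < n) n%:R * (x 0 k * x 0 k) < \sum_(k < n) 1.
  apply: ltr_sum => [|k _]; last first.
    have := small k; rewrite -ltNge => lt1.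
    have : (Num.sqrt n%:R * `|x 0 k|) ^+ 2 < 1.
      by rewrite expr_lt1// mulr_ge0// sqrtr_ge0.
    by rewrite exprMn sqr_sqrtr ?ler0n// real_normK ?num_real.
  (* Strictness of the sum needs an index; for [n = 0] the sphere is empty. *)
  apply/hasP; move: xS; rewrite /dot; case: (n) => [|m] in x small *.
    by rewrite big_ord0 => /eqP; rewrite eq_sym oner_eq0.
  by exists ord0; rewrite ?mem_index_enum.
by rewrite -mulr_sumr -/(dot x x) xS mulr1 sumr_const card_ord ltxx.
Qed.

Lemma l0norm_sum x : (l0norm x)%:R = \sum_(k < n) (x 0 k != 0)%:R :> R.
Proof.
rewrite /l0norm -sum1dep_card natr_sum big_mkcond/=.
by apply: eq_bigr => k _; case: ifP.
Qed.

Lemma capped_l1_le_l0norm upsilon x : capped_l1 upsilon x <= (l0norm x)%:R.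
Proof.
rewrite l0norm_sum; apply: ler_sum => k _.
by case: eqVneq => [->|_] /=; rewrite ge_min ?lexx ?orbT// normr0 mulr0 lexx.
Qed.

Lemma capped_l1_eq_l0norm upsilon x :
  (forall k, x 0 k != 0 -> 1 <= upsilon * `|x 0 k|) ->
  capped_l1 upsilon x = (l0norm x)%:R.
Proof.
move=> large; rewrite l0norm_sum; apply: eq_bigr => k _.
case: eqVneq => [->|/large/min_idPr//] /=.
by rewrite normr0 mulr0 min_l.
Qed.

(** When [a] shrinks to [a - t], [b] must grow to [s] to keep the sum of squares. Expanding
    [(s - b) ^ 2 >= 0] gives [2 b (s - b) <= s ^ 2 - b ^ 2 = 2 a t - t ^ 2]. *)
Lemma transfer_bounds (a b t : R) : 0 < b -> 0 <= t -> t <= a ->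
  let s := Num.sqrt (b ^+ 2 + a ^+ 2 - (a - t) ^+ 2) in
  [/\ s ^+ 2 = b ^+ 2 + a ^+ 2 - (a - t) ^+ 2, b <= s & s - b <= t * (a / b)].
Proof.
move=> b0 t0 ta s.
have at2 : (a - t) ^+ 2 <= a ^+ 2.
  by rewrite ler_pXn2r ?nnegrE ?subr_ge0 ?(le_trans t0)// lerBlDr lerDl.
have sE : s ^+ 2 = b ^+ 2 + a ^+ 2 - (a - t) ^+ 2.
  by rewrite sqr_sqrtr// -addrA addr_ge0 ?sqr_ge0// subr_ge0.
have s0 : 0 <= s by rewrite sqrtr_ge0.
have bs : b <= s.
  by rewrite -(ler_pXn2r (n := 2)) ?nnegrE ?(ltW b0)// sE -addrA lerDl subr_ge0.
split=> //; rewrite mulrA ler_pdivlMr//.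
have : 0 <= (s - b) ^+ 2 by rewrite sqr_ge0.
have := sqr_ge0 t; lra.
Qed.

Lemma sphere_transfer x (i j : 'I_n) (t : R) :
  sphere x -> i != j -> x 0 j != 0 -> 0 <= t -> t <= `|x 0 i| ->
  exists y, [/\ sphere y, `|y 0 i| = `|x 0 i| - t, `|x 0 j| <= `|y 0 j|,
    forall k, k != i -> k != j -> y 0 k = x 0 k
    & enorm (y - x) <= t * (1 + `|x 0 i| / `|x 0 j|)].
Proof.
move=> xS ij xj0 t0 ti.
have bj : 0 < `|x 0 j| by rewrite normr_gt0.
have [] := transfer_bounds bj t0 ti.
set s := Num.sqrt _ => sE bs sb.
have s0 : 0 <= s by rewrite sqrtr_ge0.
(* Signs are kept, so each entry moves by exactly the change of its absolute value. *)
pose y : 'rV[R]_n := \row_k (if k == i then Num.sg (x 0 i) * (`|x 0 i| - t)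
  else if k == j then Num.sg (x 0 j) * s else x 0 k).
have ji : (j == i) = false by rewrite eq_sym (negbTE ij).
have yi : y 0 i = Num.sg (x 0 i) * (`|x 0 i| - t) by rewrite mxE eqxx.
have yj : y 0 j = Num.sg (x 0 j) * s by rewrite mxE ji eqxx.
have yk k : k != i -> k != j -> y 0 k = x 0 k.
  by rewrite mxE => /negbTE-> /negbTE->.
have nyj : `|y 0 j| = s by rewrite yj normrM normr_sg xj0 mul1r ger0_norm.
have nyi : `|y 0 i| = `|x 0 i| - t.
  rewrite yi normrM normr_sg ger0_norm ?subr_ge0//.
  (* A zero entry has sign 0, but then [t = 0] too. *)
  have [xi0|_] := eqVneq (x 0 i) 0; last by rewrite mul1r.
  by move: ti t0; rewrite xi0 normr0 /=; lra.
have sq (z : R) : z * z = `|z| ^+ 2 by rewrite real_normK ?num_real.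
exists y; split=> //.
- rewrite /sphere/= -[RHS](xS : dot x x = 1) /dot !(sum_split2 _ ij) !sq nyi nyj sE.
  rewrite (@eq_bigr _ _ _ _ _ _ _ (fun k => x 0 k * x 0 k)); last first.
    by move=> k /andP[ki kj]; rewrite yk.
  ring.
- by rewrite nyj.
- have di : `|(y - x) 0 i| <= t.
    rewrite !mxE eqxx {3}[x 0 i]numEsg -mulrBr normrM normr_sg.
    have -> : `|x 0 i| - t - `|x 0 i| = - t by ring.
    by rewrite normrN (ger0_norm t0); case: (x 0 i != 0) => /=; lra.
  have dj : `|(y - x) 0 j| <= t * (`|x 0 i| / `|x 0 j|).
    rewrite !mxE ji eqxx {2}[x 0 j]numEsg -mulrBr normrM normr_sg xj0 mul1r.
    by rewrite ger0_norm ?subr_ge0.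
  have z0 : 0 <= t * (`|x 0 i| / `|x 0 j|) by rewrite mulr_ge0// divr_ge0.
  (* Only two entries move, and [p ^ 2 + q ^ 2 <= (p + q) ^ 2] for nonnegative [p], [q]. *)
  rewrite mulrDr mulr1 /enorm /dot (sum_split2 _ ij) big1 => [|k /andP[ki kj]].
    rewrite -[leRHS]ger0_norm ?addr_ge0// -sqrtr_sqr ler_wsqrtr// !sq.
    have := normr_ge0 ((y - x) 0 i); have := normr_ge0 ((y - x) 0 j).
    nra.
  by rewrite mxE [(- x) 0 k]mxE yk// subrr mulr0.
Qed.

(** Entry [i] stays in the linear range of the cap and entry [j] in the saturated one, so only the
    term of [i] changes. *)
Lemma capped_l1_transfer upsilon x y (i j : 'I_n) :
  0 <= upsilon -> i != j -> upsilon * `|x 0 i| <= 1 ->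
  `|y 0 i| <= `|x 0 i| -> 1 <= upsilon * `|x 0 j| -> `|x 0 j| <= `|y 0 j| ->
  (forall k, k != i -> k != j -> y 0 k = x 0 k) ->
  capped_l1 upsilon y = capped_l1 upsilon x - upsilon * (`|x 0 i| - `|y 0 i|).
Proof.
move=> u0 ij xi yi xj yj yk; rewrite /capped_l1 !(sum_split2 _ ij).
rewrite (@eq_bigr _ _ _ _ _ _ _
  (fun k => Num.min (upsilon * `|x 0 k|) 1)); last first.
  by move=> k /andP[ki kj]; rewrite yk.
have uy : upsilon * `|y 0 i| <= upsilon * `|x 0 i| by rewrite ler_wpM2l.
rewrite (min_l xi) (min_l (le_trans uy xi)) (min_r xj).
rewrite min_r; last by rewrite (le_trans xj)// ler_wpM2l.
ring.
Qed.

(** * Descent for (P1) along these moves *)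

Section penalty.
Variables (f : 'rV[R]_n -> R) (L sigma upsilon : R).
Hypotheses (L_ge0 : 0 <= L) (f_lip : elipschitz L f).
Hypotheses (sigma_gt0 : 0 < sigma) (upsilon_gt0 : 0 < upsilon).
Hypothesis upsilon_ge : L / sigma + Num.sqrt n%:R <= upsilon.

(** These are exactly the entries where the capped term differs from the indicator of being
    nonzero. *)
Definition small_entry x k := (x 0 k != 0) && (upsilon * `|x 0 k| < 1).

Lemma sqrtn_le_upsilon : Num.sqrt n%:R <= upsilon.
Proof. by apply: le_trans upsilon_ge; rewrite lerDr divr_ge0// ltW. Qed.

(* The slope of the decrease is sigma * upsilon - L * (1 + a / b) for a = |x_i|
   and b = |x_j|, with 1 / b <= sqrt n and L * a <= sigma * upsilon * a < sigma. *)
Lemma P1_transfer x (i j : 'I_n) (t : R) :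
  sphere x -> small_entry x i -> 1 <= Num.sqrt n%:R * `|x 0 j| ->
  0 < t -> t <= `|x 0 i| ->
  exists y, [/\ sphere y, P1_obj f sigma upsilon y < P1_obj f sigma upsilon x,
    `|y 0 i| = `|x 0 i| - t, `|x 0 j| <= `|y 0 j| &
    (forall k, k != i -> k != j -> y 0 k = x 0 k) /\
    enorm (y - x) <= t * (1 + `|x 0 i| / `|x 0 j|)].
Proof.
move=> xS /andP[xi0 xi1] xj t0 ti.
have sn0 : 0 <= Num.sqrt (n%:R : R) by rewrite sqrtr_ge0.
have xj1 : 1 <= upsilon * `|x 0 j|.
  by apply: le_trans xj _; rewrite ler_wpM2r// sqrtn_le_upsilon.
have ij : i != j by apply: contraTneq xi1 => ->; rewrite -leNgt.
have bj : 0 < `|x 0 j|.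
  rewrite lt_def normr_ge0 andbT; apply: contraTneq xj => ->.
  by rewrite mulr0 -ltNge ltr01.
have [|y [yS yi yj yk yx]] := sphere_transfer xS ij _ (ltW t0) ti.
  by rewrite -normr_gt0.
exists y; split=> //.
rewrite /P1_obj (capped_l1_transfer _ ij _ _ xj1 yj yk) ?yi ?ltW//; last by lra.
have fyx : f y - f x <= L * (t * (1 + `|x 0 i| / `|x 0 j|)).
  by rewrite (le_trans (ler_norm _))// (le_trans (f_lip _ _))// ler_wpM2l.
have slope : L * (1 + `|x 0 i| / `|x 0 j|) < sigma * upsilon.
  have Lsu : L + sigma * Num.sqrt n%:R <= sigma * upsilon.
    have -> : L + sigma * Num.sqrt n%:R = sigma * (L / sigma + Num.sqrt n%:R).
      by field; rewrite gt_eqF.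
    by rewrite ler_pM2l.
  have La : L * `|x 0 i| < sigma.
    apply: (@le_lt_trans _ _ (sigma * (upsilon * `|x 0 i|))).
      rewrite mulrA ler_wpM2r//.
      by have := mulr_ge0 (ltW sigma_gt0) sn0; lra.
    by rewrite gtr_pMr.
  have : L * `|x 0 i| / `|x 0 j| < sigma * Num.sqrt n%:R.
    rewrite ltr_pdivrMr//; apply: lt_le_trans La _.
    by rewrite -mulrA ler_peMr// ltW.
  lra.
have := mulr_gt0 t0; nra.
Qed.

Lemma local_minimizer_no_small_entry x :
  local_minimizers sphere (P1_obj f sigma upsilon) x ->
  forall k, ~~ small_entry x k.
Proof.
move=> [xS /nbhs_ballP[e/= e0 xe]] i; apply/negP => xi.
have [j xj] := sphere_large_entry xS.
have xi0 : 0 < `|x 0 i| by rewrite normr_gt0; case/andP: xi.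
pose c := 1 + `|x 0 i| / `|x 0 j|.
have c0 : 0 < c by rewrite ltr_wpDr// divr_ge0.
(* The second bound keeps the displacement [t * c] at most [e / 2], inside the ball of radius
   [e]. *)
pose t := Num.min `|x 0 i| (e / 2 / c).
have t0 : 0 < t by rewrite lt_min xi0 !divr_gt0.
have [|y [yS yx _ _ [_ dyx]]] := P1_transfer xS xi xj t0.
  by rewrite ge_min lexx.
suff : ball x e y by move=> /xe/(_ yS); rewrite leNgt yx.
(* Balls are entrywise, and each entry is bounded by [enorm]. *)
split=> // l k; rewrite ord1 -ball_normE /ball_/= distrC.
have -> : y 0 k - x 0 k = (y - x) 0 k by rewrite !mxE.
apply: le_lt_trans (entry_le_enorm _ _) _; apply: le_lt_trans dyx _.
have : t * c <= e / 2 by rewrite -ler_pdivlMr// ge_min lexx orbT.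
rewrite /c; lra.
Qed.

Lemma exists_no_small_entry x : sphere x ->
  exists y, [/\ sphere y,
    P1_obj f sigma upsilon y <= P1_obj f sigma upsilon x &
    forall k, ~~ small_entry y k].
Proof.
have [m] := ubnP #|[set k | small_entry x k]%SET|.
elim: m x => // m IH x; rewrite ltnS => xm xS.
have [[i xi]|none] := pselect (exists i, small_entry x i); last first.
  by exists x; split=> // k; apply/negP => xk; apply: none; exists k.
have [j xj] := sphere_large_entry xS.
have xi0 : 0 < `|x 0 i| by rewrite normr_gt0; case/andP: xi.
have [y [yS yx yi yj [yk _]]] := P1_transfer xS xi xj xi0 (lexx _).
have [|z [zS zy zk]] := IH y _ yS; last first.
  by exists z; split=> //; apply: le_trans zy (ltW yx).
(* Entry [i] became 0, entry [j] is still large and the others are unchanged, so the set of small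
   entries loses [i] and gains nothing. *)
apply: leq_trans xm; apply: proper_card; apply/properP; split.
  apply/fintype.subsetP => k; rewrite !inE => yk0.
  have ki : k != i.
    apply: contraTneq yk0 => ->; rewrite /small_entry -normr_eq0 yi subrr.
    by rewrite eqxx.
  have kj : k != j.
    apply: contraTneq yk0 => ->; rewrite /small_entry negb_and -leNgt.
    apply/orP; right; apply: le_trans xj _.
    by apply: ler_pM => //; rewrite ?sqrtr_ge0// sqrtn_le_upsilon.
  by move: yk0; rewrite /small_entry yk.
by exists i; rewrite !inE// /small_entry -normr_eq0 yi subrr eqxx.
Qed.

Lemma P1_le_P0 x : P1_obj f sigma upsilon x <= P0_obj f sigma x.
Proof. by rewrite lerD2l ler_pM2l// capped_l1_le_l0norm. Qed.

Lemma P1_eq_P0 x : (forall k, ~~ small_entry x k) ->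
  P1_obj f sigma upsilon x = P0_obj f sigma x.
Proof.
move=> xk; rewrite /P1_obj capped_l1_eq_l0norm// => k xk0.
by have := xk k; rewrite /small_entry xk0 -leNgt.
Qed.

End penalty.
End sphere_descent.

(** * Comparison of the minimizers *)

Theorem theorem3p3 (R : realType) (n : nat) (f : 'rV[R]_n -> R)
    (Lf0 Lf sigma upsilon : R)
    (f_smooth : smooth f)
    (Lf0_ge0 : 0 <= Lf0) (f_lip : elipschitz Lf0 f)
    (Lf_ge0 : 0 <= Lf)
    (f_descent : forall x y : 'rV[R]_n,
      f y <= f x + dot (grad f x) (y - x) + Lf / 2 * enorm (y - x) ^+ 2)
    (sigma_gt0 : 0 < sigma) (upsilon_gt0 : 0 < upsilon)
    (upsilon_ge : Lf0 / sigma + Num.sqrt n%:R <= upsilon) :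
  global_minimizers sphere (P0_obj f sigma) =
    global_minimizers sphere (P1_obj f sigma upsilon) /\
  local_minimizers sphere (P1_obj f sigma upsilon) `<=`
    local_minimizers sphere (P0_obj f sigma).
Proof.
have loc := @local_minimizer_no_small_entry _ _ _ _ _ _
  Lf0_ge0 f_lip sigma_gt0 upsilon_gt0 upsilon_ge.
have P10 := @P1_le_P0 _ _ f sigma upsilon sigma_gt0.
split; last first.
  (* The objectives agree at [x], and that of (P0) dominates nearby. *)
  move=> x x_loc; have /P1_eq_P0 xE := loc _ x_loc.
  case: x_loc => xS x_min; split=> //.
  by apply: filterS x_min => y /[apply]; rewrite xE => /le_trans; apply.
apply/seteqP; split=> x [xS x_min]; split=> // y yS; last first.
  (* A global minimizer of (P1) is also a local one. *)
  have /P1_eq_P0 <- : forall k, ~~ small_entry upsilon x k.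
    by apply: loc; split=> //; apply: filterE.
  exact: le_trans (x_min _ yS) (P10 y).
(* With [z] obtained from [y], the chain is [P1 x <= P0 x <= P0 z = P1 z <= P1 y]. *)
have [z [zS zy /P1_eq_P0 zE]] := exists_no_small_entry
  Lf0_ge0 f_lip sigma_gt0 upsilon_gt0 upsilon_ge yS.
by rewrite (le_trans (P10 x))// (le_trans (x_min _ zS))// -zE.
Qed.
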